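(* Let $\mathcal{C}_{\mathrm{PQD}}$ be the class of positively quadrant dependent bivariate copulas and $\mathcal{C}_{\mathrm{RS}}$ the class of radially symmetric bivariate copulas. Then $$\{(\xi(C),\beta(C)):C\in\mathcal{C}_{\mathrm{PQD}}\}=\{(\xi(C),\beta(C)):C\in\mathcal{C}_{\mathrm{PQD}}\cap\mathcal{C}_{\mathrm{RS}}\}=\{(x,y)\in[0,1]^2:y^3\le 2x\}.$$
   Context: A bivariate copula is a function $C\colon[0,1]^2\to[0,1]$ with $C(u,0)=C(0,v)=0$, $C(u,1)=u$, $C(1,v)=v$ for all $u,v\in[0,1]$, and $C(v_1,v_2)-C(u_1,v_2)-C(v_1,u_2)+C(u_1,u_2)\ge 0$ whenever $u_1\le v_1$, $u_2\le v_2$. For a copula $C$, Chatterjee's rank correlation is $\xi(C)=6\int_0^1\int_0^1(\partial_1C(u,v))^2\,\mathrm{d}u\,\mathrm{d}v-2$ (partial derivative in the first argument, understood a.e.), and Blomqvist's beta is $\beta(C)=4C(\tfrac12,\tfrac12)-1$. $C$ is positively quadrant dependent if $C(u,v)\ge uv$ for all $u,v\in[0,1]$, and radially symmetric if $C(u,v)=u+v-1+C(1-u,1-v)$ for all $u,v\in[0,1]$. *)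

(* Defs.v *)
From HB Require Import structures.
From mathcomp Require Import all_boot all_order all_algebra.
From mathcomp Require Import all_classical all_reals all_analysis.

Set Implicit Arguments.
Unset Strict Implicit.
Unset Printing Implicit Defensive.

Import Order.TTheory GRing.Theory Num.Theory.
Import numFieldNormedType.Exports.

Local Open Scope classical_set_scope.
Local Open Scope ring_scope.

(* A function on [0,1]^2 is encoded as a total function R -> R -> R that is
   constrained only on [0,1]^2; its values elsewhere are irrelevant. *)
Definition copula (R : realType) (C : R -> R -> R) : Prop :=
  [/\ forall u v, u \in `[0, 1] -> v \in `[0, 1] -> C u v \in `[0, 1],
      forall u, u \in `[0, 1] -> C u 0 = 0 /\ C u 1 = u,
      forall v, v \in `[0, 1] -> C 0 v = 0 /\ C 1 v = v &
      forall u1 u2 v1 v2,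
        u1 \in `[0, 1] -> u2 \in `[0, 1] -> v1 \in `[0, 1] -> v2 \in `[0, 1] ->
        u1 <= v1 -> u2 <= v2 ->
        0 <= C v1 v2 - C u1 v2 - C v1 u2 + C u1 u2].

(* For a copula and v in [0,1], C(., v) is 1-Lipschitz on [0,1], hence
   differentiable at almost every u in ]0,1[; at the remaining points
   [partial1 C u v] is a junk value, which the integrals below ignore. In
   particular, the values of C outside [0,1]^2 can affect it only at
   u = 0 and u = 1. *)
Definition partial1 (R : realType) (C : R -> R -> R) (u v : R) : R :=
  derive1 (fun t => C t v) u.

Definition chatterjee_xi (R : realType) (C : R -> R -> R) : R :=
  6 * (\int[lebesgue_measure]_(v in `[0, 1])
         \int[lebesgue_measure]_(u in `[0, 1]) (partial1 C u v) ^+ 2) - 2.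

Definition blomqvist_beta (R : realType) (C : R -> R -> R) : R :=
  4 * C 2^-1 2^-1 - 1.

Definition copula_PQD (R : realType) : set (R -> R -> R) :=
  [set C | copula C /\
    forall u v, u \in `[0, 1] -> v \in `[0, 1] -> u * v <= C u v].

Definition copula_RS (R : realType) : set (R -> R -> R) :=
  [set C | copula C /\
    forall u v, u \in `[0, 1] -> v \in `[0, 1] ->
      C u v = u + v - 1 + C (1 - u) (1 - v)].

Arguments copula_PQD : clear implicits.
Arguments copula_RS : clear implicits.

(* Main.v *)
Require Import Defs.
From HB Require Import structures.
From mathcomp Require Import all_boot all_order all_algebra.
From mathcomp Require Import all_classical all_reals all_analysis.
From mathcomp Require Import measurable_realfun ring lra.

(** Fix [v] and put [g = C (1/2) v], [h = g - v/2]. The slice [u |-> C u v] is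
    nondecreasing and 1-Lipschitz, so it is the integral of its a.e. derivative
    [d], which takes values in [0,1] (lemma [lipschitz_density]). On the two
    halves of [0,1] the means of [d] are [2 g] and [2 (v - g)], so convexity of
    the square gives [int d^2 >= 2 g^2 + 2 (v - g)^2 = v^2 + 4 h^2], while
    [d^2 <= d] gives [int d^2 <= v] (lemma [copula_slice_bounds]). Integrating
    the upper bound over [v] yields [xi <= 1].

    For the lower bound, write [y] for Blomqvist's beta, so that
    [h (1/2) = y / 4]. As [C (1/2)] is nondecreasing and 1-Lipschitz, [h] has
    slopes in [-1/2, 1/2]; together with [h >= 0], which is positive quadrant
    dependence, [h] lies above the tent of height [y / 4] and slopes [1/2]
    centred at [1/2]. The square of that tent has integral [y^3 / 48], whence
    [xi >= y^3 / 2] (lemma [chatterjee_xi_PQD]).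

    Conversely, take for [h] the tent itself. This fixes the conditional law of
    [V] on each of the events [U <= 1/2] and [U > 1/2]. Making [U] and [V]
    conditionally independent on each half gives the equality case
    [xi = y^3 / 2]; making them comonotone on each half turns [V] into a
    function of [U] and gives [xi = 1]. The mixture with weight [t] on the
    comonotone copula (definition [half_split]) is radially symmetric and
    positively quadrant dependent, has beta equal to [y], and has
    [xi = (1 - t^2) (y^3 / 2) + t^2] (lemma [half_split_xi]), which sweeps the
    whole interval from [y^3 / 2] to [1]. *)

Set Implicit Arguments.
Unset Strict Implicit.
Unset Printing Implicit Defensive.

Import Order.TTheory GRing.Theory Num.Theory.
Import numFieldNormedType.Exports.

Local Open Scope classical_set_scope.
Local Open Scope ring_scope.

(** * Integrals of possibly non-measurable nonnegative functions *)

Section nonmeasurable_integrands.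
Import HBNNSimple.

(** The integral of a nonnegative function is a supremum over the simple functions
    below it, so it is monotone for every function; a null set is discarded by
    killing the simple function there. The derivative of a slice, left arbitrary
    where it does not exist, and the inner integral as a function of [v] can thus
    be compared with measurable functions without proving them measurable. *)
Lemma ge0_ae_le_integral_nomeas d (T : measurableType d) (R : realType)
    (mu : {measure set T -> \bar R}) (D : set T) (f g : T -> \bar R) :
  measurable D ->
  (forall x, D x -> (0 <= f x)%E) -> (forall x, D x -> (0 <= g x)%E) ->
  {ae mu, forall x, D x -> (f x <= g x)%E} ->
  (\int[mu]_(x in D) f x <= \int[mu]_(x in D) g x)%E.
Proof.
move=> mD f0 g0 [N [mN N0 subN]].
rewrite ge0_integralE// [leRHS]ge0_integralE//.
apply: ge_ereal_sup => _ [s /= sf <-].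
have mNC : measurable (~` N) by exact: measurableC.
have -> : sintegral mu s = sintegral mu (proj_nnsfun s mNC).
  have E (h : {nnsfun T >-> R}) : sintegral mu h =
      (\int[mu]_x (h x)%:E)%E.
    by rewrite integral_nnsfun// patch_setT.
  rewrite !E; apply: ge0_ae_eq_integral => //.
  - exact/measurable_EFinP/measurable_funTS.
  - exact/measurable_EFinP/measurable_funTS.
  - by move=> x _; rewrite lee_fin.
  - by move=> x _; rewrite lee_fin.
  exists N; split => // x /= sx; apply: contrapT => Nx; apply: sx => _.
  by rewrite /= mindicE mem_set// mulr1.
apply: ereal_sup_ubound => /=; exists (proj_nnsfun s mNC) => //= x.
have fx0 : (0 <= (g \_ D) x)%E.
  by rewrite patchE; case: ifPn => // /set_mem /g0.
rewrite mindicE; case: (boolP (x \in ~` N)) => [/set_mem Nx|_]; last first.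
  by rewrite mulr0.
rewrite mulr1; apply: le_trans (sf x) _; rewrite !patchE; case: ifPn => //.
move=> /set_mem Dx; apply: contrapT => fg; apply: Nx; apply: subN => /= /(_ Dx).
by [].
Qed.

Lemma ge0_ae_eq_integral_nomeas d (T : measurableType d) (R : realType)
    (mu : {measure set T -> \bar R}) (D : set T) (f g : T -> \bar R) :
  measurable D ->
  (forall x, D x -> (0 <= f x)%E) -> (forall x, D x -> (0 <= g x)%E) ->
  ae_eq mu D f g ->
  (\int[mu]_(x in D) f x = \int[mu]_(x in D) g x)%E.
Proof.
move=> mD f0 g0 fg; apply/le_anti/andP; split;
  apply: ge0_ae_le_integral_nomeas => //;
  by apply: filterS fg => x fg Dx; rewrite fg.
Qed.

(** Only the integrable upper bound [h] keeps the integral of [g] finite; the real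
    value assigned to an infinite integral is [0], for which the lower bound
    could fail. *)
Lemma ge0_le_Rintegral_between d (T : measurableType d) (R : realType)
    (mu : {measure set T -> \bar R}) (D : set T) (f g h : T -> R) :
  measurable D -> mu.-integrable D (EFin \o h) ->
  (forall x, D x -> 0 <= f x <= g x) -> (forall x, D x -> g x <= h x) ->
  \int[mu]_(x in D) f x <= \int[mu]_(x in D) g x <= \int[mu]_(x in D) h x.
Proof.
move=> mD ih fg gh.
have f0 x : D x -> (0 <= (f x)%:E)%E by rewrite lee_fin => /fg/andP[].
have g0 x : D x -> (0 <= (g x)%:E)%E.
  by rewrite lee_fin => /fg/andP[/le_trans]; apply.
have h0 x : D x -> (0 <= (h x)%:E)%E.
  by move=> Dx; apply: le_trans (g0 _ Dx) _; rewrite lee_fin gh.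
have ifg : (\int[mu]_(x in D) (f x)%:E <= \int[mu]_(x in D) (g x)%:E)%E.
  apply: ge0_ae_le_integral_nomeas => //; apply: aeW => x Dx.
  by rewrite lee_fin; have /andP[] := fg _ Dx.
have igh : (\int[mu]_(x in D) (g x)%:E <= \int[mu]_(x in D) (h x)%:E)%E.
  apply: ge0_ae_le_integral_nomeas => //; apply: aeW => x Dx.
  by rewrite lee_fin gh.
have hfin := integrable_fin_num mD ih.
have gfin : (\int[mu]_(x in D) (g x)%:E)%E \is a fin_num.
  rewrite ge0_fin_numE; first by apply: le_lt_trans igh _; rewrite ltey_eq hfin.
  exact: integral_ge0.
have ffin : (\int[mu]_(x in D) (f x)%:E)%E \is a fin_num.
  rewrite ge0_fin_numE; first by apply: le_lt_trans ifg _; rewrite ltey_eq gfin.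
  exact: integral_ge0.
by rewrite /Rintegral !fine_le.
Qed.

End nonmeasurable_integrands.

(** * Almost everywhere derivatives of Lipschitz functions *)

Section lipschitz_density.
Context {R : realType}.
Notation mu := (@lebesgue_measure R).

Lemma lebesgue_stieltjes_itv (G : cumulative R R) (x y : R) : x <= y ->
  lebesgue_stieltjes_measure G `]x, y]%classic = (G y - G x)%:E.
Proof.
move=> xy; rewrite /lebesgue_stieltjes_measure /measure_extension.
by rewrite measurable_mu_extE/= ?wlength_itv_bnd//; exact: is_ocitv.
Qed.

(** [G] and [id - G] are both cumulative, and their Lebesgue-Stieltjes measures
    add up to the Lebesgue measure because they do so on intervals. *)
Lemma lebesgue_stieltjes_le_lebesgue (G : cumulative R R) :
  (forall x y, x <= y -> G y - G x <= y - x) ->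
  forall A, measurable A -> (lebesgue_stieltjes_measure G A <= mu A)%E.
Proof.
move=> G1 A mA; pose K x := x - G x.
have cG : right_continuous G by exact: cumulative_is_right_continuous.
have Knd : nondecreasing K.
  by move=> x y xy; rewrite /K; have := G1 _ _ xy; lra.
have Krc : right_continuous K.
  by move=> x; apply: cvgB; [exact: cvg_within|exact: cG].
pose K' : cumulative R R := HB.pack K (isCumulative.Build R _ R K Knd Krc).
pose m1 : {measure set (measurableTypeR R) -> \bar R} :=
  lebesgue_stieltjes_measure G.
pose m2 : {measure set (measurableTypeR R) -> \bar R} :=
  lebesgue_stieltjes_measure K'.
have m12 X : measure_add m1 m2 X = (m1 X + m2 X)%E by exact: measure_addE.
suff -> : mu A = (m1 A + m2 A)%E by rewrite leeDl.
rewrite -m12; apply: lebesgue_measure_unique => // _ [[x y] _ <-] /=.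
apply: etrans (esym (m12 _)).
have [xy|yx] := leP x y; last first.
  by rewrite set_itv_ge ?bnd_simp -?leNgt ?(ltW yx)// !measure0 adde0.
rewrite /lebesgue_measure.
have L (H : cumulative R R) := lebesgue_stieltjes_itv H xy.
apply: etrans (esym (congr2 adde (L G) (L K'))).
rewrite L; have E : y - x = (G y - G x) + (K y - K x) by rewrite /K; ring.
exact: (congr1 EFin E).
Qed.

(** Lebesgue's theorem for nondecreasing 1-Lipschitz functions: the
    Lebesgue-Stieltjes measure of [F] is dominated by the Lebesgue measure, its
    Radon-Nikodym density recovers the increments of [F], and by Lebesgue
    differentiation it coincides almost everywhere with the derivative of [F]. *)
Lemma lipschitz_density (a b : R) (F : R -> R) : a <= b ->
  (forall x y, a <= x -> x <= y -> y <= b -> 0 <= F y - F x <= y - x) ->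
  exists f : R -> R, [/\ measurable_fun setT f, forall x, 0 <= f x <= 1,
    forall x, a <= x <= b -> \int[mu]_(t in `[a, x]) f t = F x - F a &
    {ae mu, forall u, u \in `]a, b[ -> derive1 F u = f u}].
Proof.
move=> ab F1.
(* A cumulative function lives on the whole line, so [F] is extended by
   constants; restricting its measure to [a, b] makes that measure finite. *)
pose cl (x : R) := Num.max a (Num.min x b).
have clab x : a <= cl x <= b.
  by rewrite /cl le_max lexx ge_max ab ge_min lexx orbT.
have cl_id x : a <= x <= b -> cl x = x.
  by move=> /andP[ax xb]; rewrite /cl min_l// max_r.
have cl_lip x y : x <= y -> 0 <= cl y - cl x <= y - x.
  move=> xy; rewrite /cl; case: (leP x b) => xb; case: (leP y b) => yb;
    rewrite ?maxEle; do ?case: ifPn; rewrite -?ltNge; lra.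
pose G := F \o cl.
have G1 x y : x <= y -> 0 <= G y - G x <= y - x.
  move=> xy; have /andP[c0 c1] := cl_lip _ _ xy.
  have /andP[ax xb] := clab x; have /andP[ay yb] := clab y.
  have /(_ ax _ yb) := F1 (cl x) (cl y); rewrite -subr_ge0 => /(_ c0) /andP[-> h].
  by rewrite /= (le_trans h).
have Gnd : nondecreasing G by move=> x y /G1 /andP[]; rewrite subr_ge0.
have Gcont : continuous G.
  move=> x; apply/cvgrPdist_le => e e0; near=> y.
  apply: (@le_trans _ _ `|x - y|).
    have [xy|/ltW yx] := leP x y.
      have /andP[g0 g1] := G1 _ _ xy; rewrite distrC [leRHS]distrC.
      by rewrite !ger0_norm// subr_ge0.
    have /andP[g0 g1] := G1 _ _ yx.
    by rewrite !ger0_norm// subr_ge0.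
  by near: y; apply: cvgr_dist_le => //; exact: cvg_id.
have Grc := right_continuousW Gcont.
pose G' : cumulative R R := HB.pack G (isCumulative.Build R _ R G Gnd Grc).
pose mG : {measure set (measurableTypeR R) -> \bar R} :=
  lebesgue_stieltjes_measure G'.
have mGitv x y : x <= y -> mG `]x, y]%classic = (G y - G x)%:E.
  exact: (lebesgue_stieltjes_itv G').
have mab : measurable (`]a, b]%classic : set (measurableTypeR R)).
  exact: measurable_itv.
have mGab : (mG `]a, b]%classic < +oo)%E by rewrite mGitv// ltry.
pose nu : {finite_measure set (measurableTypeR R) -> \bar R} :=
  mfrestr mab mGab.
have numu : nu `<< mu.
  apply/null_content_dominatesP => A mA A0; apply/eqP; rewrite -measure_le0 -A0.
  apply: le_trans (lebesgue_stieltjes_le_lebesgue (G := G') _ mA).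
    by rewrite /nu /= /mfrestr /mrestr le_measure ?inE//; exact: measurableI.
  by move=> x y /G1 /andP[].
have [g [g0 gfin ig gE]] := radon_nikodym_sigma_finite numu.
pose f0 := fine \o g.
have gf0 : EFin \o f0 = g by apply/funext => x /=; rewrite fineK.
have mf0 : measurable_fun setT f0.
  by apply/measurable_EFinP; rewrite gf0; exact: measurable_int ig.
have intf0 x : a <= x <= b -> \int[mu]_(t in `]a, x]) f0 t = F x - F a.
  move=> axb; have /andP[ax xb] := axb.
  rewrite /Rintegral -[RHS]/(fine (F x - F a)%:E); congr fine.
  under eq_integral do rewrite -[(f0 _)%:E]/((EFin \o f0) _) gf0.
  rewrite -gE; last exact: measurable_itv.
  rewrite /nu /= /mfrestr /mrestr setIidl; last exact: subset_itvl.
  by rewrite mGitv// /G /= !cl_id ?lexx.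
have if0 : mu.-integrable setT (EFin \o f0) by rewrite gf0.
pose J x := \int[mu]_(t in `]a, x]) f0 t.
have dF : {ae mu, forall u, u \in `]a, b[ ->
    derive1 F u = f0 u /\ 0 <= f0 u <= 1}.
  have ifoc y : mu.-integrable [set` Interval (BRight a) (BRight y)] (EFin \o f0).
    exact: integrableS if0.
  have lf : locally_integrable setT f0.
    by apply: open_integrable_locally => //; exact: openT.
  have := FTC1 ifoc lf.
  apply: filterS; first exact: (ae_filter_ringOfSetsType mu).
  move=> u dJ /[dup] uab; rewrite in_itv/= => /andP[au ub].
  have {dJ} [] := dJ au => dJ JE.
  have FJ : \near u, F u = J u + F a.
    near=> x; rewrite /J intf0 ?subrK//.
    have : x \in `]a, b[ by near: x; exact: near_in_itvoo.
    by rewrite in_itv/= => /andP[/ltW-> /ltW->].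
  have dF : derivable F u 1.
    apply: near_eq_derivable (derivableD dJ (derivable_cst (F a) u 1)).
    by near do apply/esym.
  have dFE : derive1 F u = f0 u.
    rewrite derive1E (near_eq_derive _ FJ) deriveD//.
    by rewrite derive_cst addr0 -derive1E.
  (* The density is a limit of difference quotients, which lie in [0, 1]. *)
  have quot : \forall h \near 0^', 0 <= h^-1 *: (F (h + u) - F u) <= 1.
    near=> h.
    have h0 : h != 0 by near: h; exact: nbhs_dnbhs_neq.
    have /andP[ah hb] : a <= h + u <= b.
      have : h \in `](a - u), (b - u)[.
        near: h; apply: nbhs_dnbhs; apply: near_in_itvoo.
        by rewrite in_itv/=; apply/andP; split; lra.
      by rewrite in_itv/= => /andP[? ?]; apply/andP; split; lra.
    have [hp|hn] := ltP 0 h.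
      have /andP[D0 D1] := F1 u (h + u) (ltW au) ltac:(lra) hb.
      rewrite /GRing.scale/= mulr_ge0 ?invr_ge0 ?(ltW hp)//=.
      by rewrite ler_pdivrMl// mulr1; lra.
    have {}hn : h < 0 by rewrite lt_neqAle h0.
    have /andP[D0 D1] := F1 (h + u) u ah ltac:(lra) (ltW ub).
    rewrite -[_ *: _]opprK -scalerN -scaleNr -invrN opprB /GRing.scale/=.
    rewrite mulr_ge0 ?invr_ge0 ?oppr_ge0 ?(ltW hn)//=.
    by rewrite ler_pdivrMl ?oppr_gt0// mulr1; lra.
  have cq : cvg ((fun h => h^-1 *: (F (h + u) - F u)) @ 0^').
    under eq_fun; first (move=> h; rewrite -{2}(scaler1 h); over).
    exact: dF.
  split => //; rewrite -dFE; apply/andP; split.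
    by apply: limr_ge => //; apply: filterS quot => h /andP[].
  by apply: limr_le => //; apply: filterS quot => h /andP[].
have aeF : Filter (almost_everywhere mu) by exact: (ae_filter_ringOfSetsType mu).
(* Clamping changes the density on a null set only and makes the bounds hold
   everywhere. *)
pose f x := Num.max 0 (Num.min (f0 x) 1).
have mf : measurable_fun setT f.
  by apply: measurable_maxr => //; exact: measurable_minr.
exists f; split => //.
- by move=> x; rewrite /f le_max lexx ge_max ler01 ge_min lexx orbT.
- move=> x axb; rewrite -intf0// /Rintegral; congr fine.
  rewrite -integral_itv_obnd_cbnd; last first.
    exact/measurable_EFinP/measurable_funTS.
  rewrite -!integral_itv_bndo_bndc; last 2 first.
    exact/measurable_EFinP/measurable_funTS.
    exact/measurable_EFinP/measurable_funTS.
  apply: ae_eq_integral => //.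
  - exact/measurable_EFinP/measurable_funTS.
  - exact/measurable_EFinP/measurable_funTS.
  apply: filterS dF => u dF; rewrite /= in_itv/= => /andP[au ux].
  have [|_ /andP[f0u fu1]] := dF.
    by rewrite in_itv/= au/=; case/andP: axb => _; exact: lt_le_trans.
  by rewrite /f min_l// max_r.
- apply: filterS dF => u dF /dF[-> /andP[f0u fu1]].
  by rewrite /f min_l// max_r.
Unshelve. all: by end_near.
Qed.

End lipschitz_density.

(** * Squares of functions with values in the unit interval *)

Section bounded_integrals.
Context {R : realType}.
Notation mu := (@lebesgue_measure R).

Lemma ae_neq (c : R) : {ae mu, forall x : R, x != c}.
Proof.
exists [set c]; split => //; first exact: lebesgue_measure_set1.
by move=> x /= /negP; rewrite negbK => /eqP.
Qed.

Lemma bounded_itv_integrable (f : R -> R) (M a b : R) :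
  measurable_fun setT f -> (forall x, `|f x| <= M) ->
  mu.-integrable `[a, b] (EFin \o f).
Proof.
move=> mf fM; apply: measurable_bounded_integrable => //.
- rewrite [X in (X < _)%E]lebesgue_measure_itv/=.
  by case: ifPn => // _; rewrite -EFinB ltry.
- exact: measurable_funTS.
- exists M; split; first exact: num_real.
  by move=> x Mx y _; apply: (le_trans (fM y)); exact: ltW.
Qed.

Lemma continuous_itv_integrable (f : R -> R) (a b : R) :
  continuous f -> mu.-integrable `[a, b] (EFin \o f).
Proof.
move=> cf; apply: continuous_compact_integrable; first exact: segment_compact.
exact: continuous_subspaceT.
Qed.

Lemma Rintegral_itv_split (f : R -> R) (a b c : R) : a <= b -> b <= c ->
  mu.-integrable `[a, c] (EFin \o f) ->
  \int[mu]_(t in `[a, c]) f t =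
  \int[mu]_(t in `[a, b]) f t + \int[mu]_(t in `[b, c]) f t.
Proof.
move=> ab bc itf.
rewrite -(@Rintegral_itv_obnd_cbnd _ b).
  by rewrite -(@Rintegral_itvB _ f (BLeft a) (BRight c))// subrKC.
by apply: integrableS itf => //; apply: subset_itv; rewrite bnd_simp.
Qed.

Lemma Rintegral_itv_cst (a b k : R) : a <= b ->
  \int[mu]_(t in `[a, b]) k = k * (b - a).
Proof.
move=> ab; rewrite Rintegral_cst//; congr (_ * _).
rewrite [X in fine X]lebesgue_measure_itv/= lte_fin; case: ifPn => //.
by rewrite -leNgt => ba; rewrite /= (le_anti (introT andP (conj ab ba))) subrr.
Qed.

Section unit_valued.
Variables (f : R -> R) (x y : R).
Hypotheses (mf : measurable_fun setT f) (f01 : forall u, 0 <= f u <= 1).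
Hypothesis xy : x <= y.

Let intf : mu.-integrable `[x, y] (EFin \o f).
Proof.
apply: (@bounded_itv_integrable _ 1) => // u; have /andP[? ?] := f01 u.
by rewrite ger0_norm.
Qed.

Let mf2 : measurable_fun setT (fun u => f u ^+ 2).
Proof. exact: measurable_funX. Qed.

Lemma sqr_integrable : mu.-integrable `[x, y] (EFin \o (fun u => f u ^+ 2)).
Proof.
apply: (@bounded_itv_integrable _ 1) => // u.
by have /andP[? ?] := f01 u; rewrite ger0_norm ?sqr_ge0// expr_le1.
Qed.

Let intaff A B : mu.-integrable `[x, y] (EFin \o (fun u => A * f u - B)).
Proof.
apply: (@bounded_itv_integrable _ (`|A| + `|B|)).
  by apply: measurable_funB => //; exact: measurable_funM.
move=> u; apply: (le_trans (ler_normB _ _)); rewrite lerD2r normrM ler_piMr//.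
by have /andP[? ?] := f01 u; rewrite ger0_norm.
Qed.

Lemma Rintegral_affine A B : \int[mu]_(u in `[x, y]) (A * f u - B) =
  A * (\int[mu]_(u in `[x, y]) f u) - B * (y - x).
Proof.
rewrite RintegralB//; last 2 first.
- have := intaff A 0; congr integrable; apply/funext => u /=.
  by rewrite subr0.
- apply: (@bounded_itv_integrable _ `|B|) => //.
by rewrite RintegralZl// Rintegral_itv_cst.
Qed.

(** Jensen's inequality in linearised form: [f^2] lies above its tangent at [c].
    The best choice of [c] is the mean of [f]. *)
Lemma Rintegral_sqr_ge c :
  2 * c * (\int[mu]_(u in `[x, y]) f u) - c ^+ 2 * (y - x) <=
  \int[mu]_(u in `[x, y]) (f u ^+ 2).
Proof.
rewrite -Rintegral_affine; apply: le_Rintegral => //; first exact: sqr_integrable.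
move=> u _; rewrite -subr_ge0.
by rewrite (_ : _ - _ = (f u - c) ^+ 2) ?sqr_ge0//; ring.
Qed.

Lemma Rintegral_sqr_le :
  \int[mu]_(u in `[x, y]) (f u ^+ 2) <= \int[mu]_(u in `[x, y]) f u.
Proof.
apply: le_Rintegral => //; first exact: sqr_integrable.
by move=> u _; have /andP[? ?] := f01 u; rewrite expr2 ler_piMr.
Qed.

(** When [f] takes only two values a.e., [f^2] is an affine function of [f], and
    its integral is known from that of [f] without locating the level sets. *)
Lemma Rintegral_sqr_eq A B :
  {ae mu, forall u, u \in `[x, y] -> f u ^+ 2 = A * f u - B} ->
  \int[mu]_(u in `[x, y]) (f u ^+ 2) =
  A * (\int[mu]_(u in `[x, y]) f u) - B * (y - x).
Proof.
move=> fAB; rewrite -Rintegral_affine /Rintegral; congr fine.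
apply: ae_eq_integral => //.
- exact: measurable_int sqr_integrable.
- exact: measurable_int (intaff A B).
have aeF : Filter (almost_everywhere mu) by exact: (ae_filter_ringOfSetsType mu).
by apply: filterS fAB => u E /E ->.
Qed.

End unit_valued.

End bounded_integrals.

(** * Slices of a copula *)

Section copula_facts.
Context {R : realType}.
Notation mu := (@lebesgue_measure R).
Variable C : R -> R -> R.
Hypothesis copC : copula C.

(** The rectangles [[x, y] * [0, v]] and [[x, y] * [v, 1]] have nonnegative
    mass. *)
Lemma copula_lipschitz_l v x y : v \in `[0, 1] -> 0 <= x -> x <= y -> y <= 1 ->
  0 <= C y v - C x v <= y - x.
Proof.
case: copC => _ C1 _ C2; rewrite in_itv/= => /andP[v0 v1] x0 xy y1.
have I0 : (0 : R) \in `[0, 1] by rewrite in_itv/= lexx ler01.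
have I1 : (1 : R) \in `[0, 1] by rewrite in_itv/= lexx ler01.
have Iv : v \in `[0, 1] by rewrite in_itv/= v0.
have Ix : x \in `[0, 1] by rewrite in_itv/= x0 (le_trans xy).
have Iy : y \in `[0, 1] by rewrite in_itv/= y1 (le_trans x0).
have := C2 _ _ _ _ Ix I0 Iy Iv xy v0; have := C2 _ _ _ _ Ix Iv Iy I1 xy v1.
have [-> ->] := C1 _ Ix; have [-> ->] := C1 _ Iy; lra.
Qed.

Lemma copula_lipschitz_r u x y : u \in `[0, 1] -> 0 <= x -> x <= y -> y <= 1 ->
  0 <= C u y - C u x <= y - x.
Proof.
case: copC => _ _ C1 C2; rewrite in_itv/= => /andP[u0 u1] x0 xy y1.
have I0 : (0 : R) \in `[0, 1] by rewrite in_itv/= lexx ler01.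
have I1 : (1 : R) \in `[0, 1] by rewrite in_itv/= lexx ler01.
have Iu : u \in `[0, 1] by rewrite in_itv/= u0.
have Ix : x \in `[0, 1] by rewrite in_itv/= x0 (le_trans xy).
have Iy : y \in `[0, 1] by rewrite in_itv/= y1 (le_trans x0).
have := C2 _ _ _ _ I0 Ix Iu Iy u0 xy; have := C2 _ _ _ _ Iu Ix I1 Iy u1 xy.
have [-> ->] := C1 _ Ix; have [-> ->] := C1 _ Iy; lra.
Qed.

(** Absolute continuity of the slices, in the form used below: the integral of the
    squared derivative is that of [f^2], and the integral of [f] over each half
    depends only on [C (1/2) v]. *)
Lemma copula_slice_density v : v \in `[0, 1] -> exists f : R -> R,
  [/\ measurable_fun setT f, forall u, 0 <= f u <= 1,
   {ae mu, forall u, u \in `]0, 1[ -> partial1 C u v = f u},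
   \int[mu]_(u in `[0, 2^-1]) f u = C 2^-1 v /\
   \int[mu]_(u in `[2^-1, 1]) f u = v - C 2^-1 v &
   \int[mu]_(u in `[0, 1]) partial1 C u v ^+ 2 =
   \int[mu]_(u in `[0, 2^-1]) f u ^+ 2 + \int[mu]_(u in `[2^-1, 1]) f u ^+ 2].
Proof.
move=> v01.
have [f [mf f01 fE df]] := lipschitz_density (F := fun u => C u v)
  (@ler01 R) (fun x y => @copula_lipschitz_l v x y v01).
have h0 : 0 <= 2^-1 :> R by lra.
have h1 : 2^-1 <= 1 :> R by lra.
have ifs : mu.-integrable `[0, 1] (EFin \o f).
  apply: (@bounded_itv_integrable _ _ 1) => // u; have /andP[? ?] := f01 u.
  by rewrite ger0_norm.
have [C0v C1v] : C 0 v = 0 /\ C 1 v = v by case: copC => _ _ /(_ _ v01).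
have fhalf : \int[mu]_(u in `[0, 2^-1]) f u = C 2^-1 v.
  by rewrite fE ?h0// C0v subr0.
exists f; split => //.
  split=> //; have := Rintegral_itv_split h0 h1 ifs.
  by rewrite fE ?lexx ?ler01// fhalf C0v C1v; lra.
rewrite -(Rintegral_itv_split h0 h1) ?sqr_integrable//.
rewrite /Rintegral; congr fine; apply: ge0_ae_eq_integral_nomeas => //.
- by move=> u _; rewrite lee_fin sqr_ge0.
- by move=> u _; rewrite lee_fin sqr_ge0.
have aeF : Filter (almost_everywhere mu) by exact: (ae_filter_ringOfSetsType mu).
apply: (filterS _ (filterI (filterI (ae_neq 0) (ae_neq 1)) df)).
move=> u [[u0 u1] dfu]; rewrite /= in_itv/= => /andP[u0' u1'].
have uoo : u \in `]0, 1[ by rewrite in_itv/= !lt_neqAle u0' u1' u1 eq_sym u0.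
by rewrite -[partial1 _ _ _]/(derive1 (fun t => C t v) u) dfu.
Qed.

(** The square exceeds its tangent at the mean of the density on each half, that
    is at [2 C (1/2) v] and [2 (v - C (1/2) v)]. *)
Lemma copula_slice_bounds v : v \in `[0, 1] ->
  v ^+ 2 + 4 * (C 2^-1 v - v / 2) ^+ 2 <=
    \int[mu]_(u in `[0, 1]) partial1 C u v ^+ 2 <= v.
Proof.
move=> /copula_slice_density[f [mf f01 _ [f1 f2] ->]].
have h0 : 0 <= 2^-1 :> R by lra.
have h1 : 2^-1 <= 1 :> R by lra.
have := Rintegral_sqr_le 0 2^-1 mf f01; have := Rintegral_sqr_le 2^-1 1 mf f01.
have := Rintegral_sqr_ge mf f01 h0 (2 * C 2^-1 v).
have := Rintegral_sqr_ge mf f01 h1 (2 * (v - C 2^-1 v)).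
rewrite f1 f2; set I1 := Rintegral _ _ _; set I2 := Rintegral _ _ _.
by move: I1 I2 (C 2^-1 v) => I1 I2 g *; apply/andP; split; nra.
Qed.

End copula_facts.

(** * The tent function *)

Section tent.
Context {R : realType}.
Notation mu := (@lebesgue_measure R).

(** The least function that has the value [y / 4] at [1/2], is nonnegative and
    has slopes in [-1/2, 1/2]; for [0 <= y <= 1] it vanishes at [0] and [1]. *)
Definition tent (y v : R) : R := Num.max 0 (y / 4 - `|v - 2^-1| / 2).

Lemma continuous_tent y : continuous (tent y).
Proof.
move=> x.
apply: (@continuous_max R R (fun=> 0) (fun v => y / 4 - `|v - 2^-1| / 2)).
  exact: cvg_cst.
apply: cvgB; first exact: cvg_cst.
apply: cvgM; last exact: cvg_cst.
by apply: cvg_norm; apply: cvgB; [exact: cvg_id|exact: cvg_cst].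
Qed.

Lemma Rintegral_is_derive (F f : R -> R) (a b : R) : a <= b ->
  continuous f -> (forall x : R, is_derive x 1 F (f x)) ->
  \int[mu]_(t in `[a, b]) f t = F b - F a.
Proof.
rewrite le_eqVlt => /predU1P[<- _ _|ab cf dF].
  by rewrite set_itv1 Rintegral_set1 subrr.
have cF x : {for x, continuous F}.
  by apply: differentiable_continuous; apply/derivable1_diffP; case: (dF x).
rewrite /Rintegral (@continuous_FTC2 _ f F)//.
- exact: continuous_subspaceT.
- split.
  + by move=> x _; case: (dF x).
  + exact: cvg_at_right_filter (cF a).
  + exact: cvg_at_left_filter (cF b).
- by move=> x _; rewrite derive1E; case: (dF x).
Qed.

Lemma Rintegral_quadratic (s k c r a b : R) : a <= b ->
  \int[mu]_(v in `[a, b]) (s * v ^+ 2 + k * (v - c) ^+ 2 + r * v) =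
  s * (b ^+ 3 - a ^+ 3) / 3 + k * ((b - c) ^+ 3 - (a - c) ^+ 3) / 3 +
  r * (b ^+ 2 - a ^+ 2) / 2.
Proof.
move=> ab.
pose F (v : R) := s / 3 * v ^+ 3 + k / 3 * (v - c) ^+ 3 + r / 2 * v ^+ 2.
transitivity (F b - F a); last by rewrite /F; field.
apply: Rintegral_is_derive => //.
- move=> x; apply: cvgD; last by apply: cvgM; [exact: cvg_cst|exact: cvg_id].
  apply: cvgD; apply: cvgM; do ?exact: cvg_cst.
    exact: exprn_continuous.
  apply: (@continuous_comp _ _ _ (fun v => v - c) (fun v => v ^+ 2)).
    by apply: cvgB; [exact: cvg_id|exact: cvg_cst].
  exact: exprn_continuous.
- move=> x; rewrite /F; apply: is_derive_eq.
  by rewrite /GRing.scale /=; field.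
Qed.

(** The coefficients [s] and [r] cover both the lower bound for a general copula
    and the exact value for the family below. *)
Lemma Rintegral_tent (y s r : R) : 0 <= y <= 1 ->
  \int[mu]_(v in `[0, 1]) (s * (v ^+ 2 + 4 * tent y v ^+ 2) + r * v) =
  s * (3^-1 + y ^+ 3 / 12) + r / 2.
Proof.
move=> /andP[y0 y1]; pose f v := s * (v ^+ 2 + 4 * tent y v ^+ 2) + r * v.
rewrite -[LHS]/(\int[mu]_(v in `[0, 1]) f v).
have cf : continuous f.
  move=> x; apply: cvgD; last by apply: cvgM; [exact: cvg_cst|exact: cvg_id].
  apply: cvgM; first exact: cvg_cst.
  apply: cvgD; first exact: exprn_continuous.
  apply: cvgM; first exact: cvg_cst.
  apply: (@continuous_comp _ _ _ (tent y) (fun v => v ^+ 2)).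
    exact: continuous_tent.
  exact: exprn_continuous.
have itf a b := @continuous_itv_integrable R f a b cf.
(* The tent vanishes outside [p, q], and [4 * tent^2] is [(v - p)^2] on the left
   of 1/2 and [(v - q)^2] on the right. *)
pose p := (1 - y) / 2; pose q := (1 + y) / 2.
rewrite (@Rintegral_itv_split _ f 0 p)//; [|rewrite /p; lra..].
rewrite (@Rintegral_itv_split _ f p 2^-1)//; [|rewrite /p; lra..].
rewrite (@Rintegral_itv_split _ f 2^-1 q)//; [|rewrite /q; lra..].
have tE k c a b : a <= b ->
    (forall v, a <= v <= b -> 4 * tent y v ^+ 2 = k * (v - c) ^+ 2) ->
    \int[mu]_(v in `[a, b]) f v = s * (b ^+ 3 - a ^+ 3) / 3 +
      s * k * ((b - c) ^+ 3 - (a - c) ^+ 3) / 3 + r * (b ^+ 2 - a ^+ 2) / 2.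
  move=> ab kc; rewrite -Rintegral_quadratic//; apply: eq_Rintegral => v.
  by rewrite inE/= in_itv/= => /kc; rewrite /f => ->; ring.
rewrite (@tE 0 0 0 p); first last.
- move=> v /andP[]; rewrite /p /tent => v0 vp.
  by rewrite ler0_norm ?max_l; [ring|lra|lra].
- by rewrite /p; lra.
rewrite (@tE 1 p p 2^-1); first last.
- move=> v /andP[]; rewrite /p /tent => v0 vp.
  by rewrite ler0_norm ?max_r; [field|lra|lra].
- by rewrite /p; lra.
rewrite (@tE 1 q 2^-1 q); first last.
- move=> v /andP[]; rewrite /q /tent => v0 vp.
  by rewrite ger0_norm ?max_r; [field|lra|lra].
- by rewrite /q; lra.
rewrite (@tE 0 0 q 1); first last.
- move=> v /andP[]; rewrite /q /tent => v0 vp.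
  by rewrite ger0_norm ?max_l; [ring|lra|lra].
- by rewrite /q; lra.
by rewrite /p /q; field.
Qed.

End tent.

(** * Bounds for positively quadrant dependent copulas *)

Section necessary.
Context {R : realType}.
Notation mu := (@lebesgue_measure R).
Variable C : R -> R -> R.
Hypothesis pqdC : copula_PQD R C.

Let copC : copula C. Proof. by case: pqdC. Qed.

Let half01 : (2^-1 : R) \in `[0, 1].
Proof. by rewrite in_itv/=; apply/andP; split; lra. Qed.

Lemma blomqvist_beta_PQD : 0 <= blomqvist_beta C <= 1.
Proof.
rewrite /blomqvist_beta; have [_ /(_ _ _ half01 half01)] := pqdC.
have h0 : 0 <= 2^-1 :> R by lra.
have h1 : 2^-1 <= 1 :> R by lra.
have := copula_lipschitz_l copC half01 (lexx 0) h0 h1.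
have [-> _] : C 0 2^-1 = 0 /\ C 1 2^-1 = 2^-1 by case: copC => _ _ /(_ _ half01).
lra.
Qed.

(** [C (1/2)] is nondecreasing and 1-Lipschitz, so going left from [1/2] lowers
    [C (1/2) v - v / 2] by at most [(1/2 - v) / 2], and going right by at most
    [(v - 1/2) / 2]; positive quadrant dependence supplies nonnegativity. *)
Lemma tent_le_PQD v : v \in `[0, 1] ->
  tent (blomqvist_beta C) v <= C 2^-1 v - v / 2.
Proof.
move=> v01; have [_ /(_ _ _ half01 v01) Cv] := pqdC.
rewrite /tent ge_max; apply/andP; split; first lra.
rewrite /blomqvist_beta; move: v01; rewrite in_itv/= => /andP[v0 v1].
have [vh|/ltW vh] := leP v 2^-1.
  have := copula_lipschitz_r copC half01 v0 vh ltac:(lra).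
  by rewrite ler0_norm; lra.
have h0 : 0 <= 2^-1 :> R by lra.
have := copula_lipschitz_r copC half01 h0 vh v1.
by rewrite ger0_norm; lra.
Qed.

Lemma chatterjee_xi_PQD :
  blomqvist_beta C ^+ 3 / 2 <= chatterjee_xi C <= 1.
Proof.
have y01 := blomqvist_beta_PQD; set y := blomqvist_beta C in y01 *.
pose f v := 1 * (v ^+ 2 + 4 * tent y v ^+ 2) + 0 * v.
pose h (v : R) := 0 * (v ^+ 2 + 4 * tent y v ^+ 2) + 1 * v.
have /andP[] : \int[mu]_(v in `[0, 1]) f v <=
    \int[mu]_(v in `[0, 1]) (\int[mu]_(u in `[0, 1]) partial1 C u v ^+ 2)
    <= \int[mu]_(v in `[0, 1]) h v.
  apply: ge0_le_Rintegral_between => //.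
  - have := @continuous_itv_integrable R idfun 0 1 (fun=> cvg_id).
    congr integrable; apply/funext => v /=.
    by rewrite /h mul0r add0r mul1r.
  - move=> v v01; have /andP[Iv _] := copula_slice_bounds copC v01.
    rewrite /f mul1r mul0r addr0; apply/andP; split.
      by rewrite addr_ge0 ?sqr_ge0// mulr_ge0// sqr_ge0.
    apply: le_trans Iv; rewrite lerD2l ler_pM2l// ler_sqr ?nnegrE.
    + exact: tent_le_PQD.
    + by rewrite /tent le_max lexx.
    + by apply: le_trans (tent_le_PQD v01); rewrite /tent le_max lexx.
  - move=> v v01; have /andP[_] := copula_slice_bounds copC v01.
    by rewrite /h mul0r add0r mul1r.
by rewrite /f /h !Rintegral_tent// /chatterjee_xi => *; apply/andP; split; lra.
Qed.

End necessary.

(** * Copulas realising the region *)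

Definition left_mass (R : realType) (y v : R) : R := v / 2 + tent y v.

Definition right_mass (R : realType) (y v : R) : R := v / 2 - tent y v.

(** The joint mass of two initial events of masses [a] and [m] inside an event of
    mass [1/2], when the coupling is a mixture of the independent one, of weight
    [1 - t], and the comonotone one, of weight [t]. *)
Definition blend (R : realType) (t a m : R) : R :=
  (1 - t) * (2 * a * m) + t * Num.min a m.

(** [left_mass y] and [right_mass y] are the distribution functions of [V] on the
    events [U <= 1/2] and [U > 1/2], each of total mass [1/2]; the two summands
    are the contributions of these events. *)
Definition half_split (R : realType) (t y u v : R) : R :=
  blend t (Num.min u 2^-1) (left_mass y v) +
  blend t (Num.max 0 (u - 2^-1)) (right_mass y v).

Lemma derive1_affine_itv (R : realType) (F : R -> R) (a b m c u : R) :
  u \in `]a, b[ ->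
  (forall z, a < z < b -> F z = m * z + c) -> derive1 F u = m.
Proof.
move=> uab FE.
have nF : \near u, m * u + c = F u.
  near=> z; rewrite FE//.
  have : z \in `]a, b[ by near: z; exact: near_in_itvoo.
  by rewrite in_itv.
have dA : is_derive u (1 : R) (fun z => m * z + c) m.
  by apply: is_derive_eq; rewrite /GRing.scale/=; ring.
by rewrite derive1E; have [_ ->] := near_eq_is_derive nF dA.
Unshelve. all: by end_near.
Qed.

Section extremal_family.
Context {R : realType}.
Notation mu := (@lebesgue_measure R).
Variables t y : R.
Hypotheses (t01 : 0 <= t <= 1) (y01 : 0 <= y <= 1).

Local Notation C := (half_split t y).

Lemma tent_symm (v : R) : tent y (1 - v) = tent y v.
Proof.
rewrite /tent -normrN opprB; congr (Num.max _ (_ - `|_| / 2)).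
by field.
Qed.

Lemma tent_lipschitz (v w : R) : v <= w -> `|tent y w - tent y v| <= (w - v) / 2.
Proof.
move=> vw; rewrite /tent ler_norml !maxEle.
by case: (ler0P (v - 2^-1)); case: (ler0P (w - 2^-1)) => *;
  do ?case: ifPn; lra.
Qed.

Lemma tent_bounds (v : R) : 0 <= v <= 1 ->
  [/\ 0 <= tent y v, tent y v <= v / 2 & tent y v <= (1 - v) / 2].
Proof.
move=> /andP[v0 v1]; have /andP[y0 y1] := y01; rewrite /tent !maxEle.
by case: (ler0P (v - 2^-1)) => *; case: ifPn => *; split; lra.
Qed.

Lemma min_2increasing (a b c d : R) : a <= b -> c <= d ->
  0 <= Num.min b d - Num.min a d - Num.min b c + Num.min a c.
Proof. by move=> ab cd; rewrite !minEle; do ?case: ifPn; lra. Qed.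

Lemma blend_2increasing (a b c d : R) : a <= b -> c <= d ->
  0 <= blend t b d - blend t a d - blend t b c + blend t a c.
Proof.
move=> ab cd; rewrite /blend; have := min_2increasing ab cd.
set p := Num.min b d; set q := Num.min a d; set r := Num.min b c.
set s := Num.min a c => pqrs.
rewrite [leRHS](_ : _ = 2 * (1 - t) * ((b - a) * (d - c)) + t * (p - q - r + s)).
  case/andP: t01 => t0 t1.
  by apply: addr_ge0; do ?apply: mulr_ge0; rewrite ?subr_ge0//.
by ring.
Qed.

Lemma blend_bounds (a m : R) : 0 <= a -> 0 <= m -> m <= 2^-1 ->
  0 <= blend t a m <= a.
Proof.
move=> a0 m0 m1; have /andP[t0 t1] := t01.
have : 0 <= 2 * a * m <= a by apply/andP; split; nra.
have : 0 <= Num.min a m <= a by rewrite ge_min lexx le_min a0 m0.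
rewrite /blend; move: (2 * a * m) (Num.min a m) => p q *.
by apply/andP; split; nra.
Qed.

Lemma mass_bounds (v : R) : 0 <= v <= 1 ->
  [/\ 0 <= left_mass y v <= 2^-1, 0 <= right_mass y v <= 2^-1 &
      v / 2 <= left_mass y v].
Proof.
move=> v01; have [h0 h1 h2] := tent_bounds v01; have /andP[v0 v1] := v01.
by rewrite /left_mass /right_mass; split; lra.
Qed.

Lemma half_split_copula : copula C.
Proof.
have tent0 : tent y 0 = 0.
  by have [] := @tent_bounds 0 ltac:(lra); lra.
have tent1 : tent y 1 = 0.
  by have [] := @tent_bounds 1 ltac:(lra); lra.
have blendE a : a <= 2^-1 -> blend t a 2^-1 = a.
  by move=> a1; rewrite /blend min_l//; field.
have split_lo (u : R) : u <= 1 ->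
    Num.min u 2^-1 <= 2^-1 /\ Num.max 0 (u - 2^-1) <= 2^-1.
  by rewrite minEle maxEle; do ?case: ifPn; lra.
have split_ge0 (u : R) : 0 <= u ->
    0 <= Num.min u 2^-1 /\ 0 <= Num.max 0 (u - 2^-1).
  by rewrite minEle maxEle; do ?case: ifPn; lra.
have split_sum (u : R) : Num.min u 2^-1 + Num.max 0 (u - 2^-1) = u.
  by rewrite minEle maxEle; do ?case: ifPn; lra.
split.
- move=> u v; rewrite !in_itv/= => /andP[u0 u1] v01.
  have [/andP[g0 g1] /andP[k0 k1] _] := mass_bounds v01.
  have [a0 b0] := split_ge0 _ u0.
  have := blend_bounds a0 g0 g1; have := blend_bounds b0 k0 k1.
  by have := split_sum u; rewrite /half_split; lra.
- move=> u; rewrite in_itv/= => /andP[u0 u1].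
  have [a0 b0] := split_ge0 _ u0; have [a1 b1] := split_lo _ u1.
  have -> : C u 0 = blend t (Num.min u 2^-1) 0 + blend t (Num.max 0 (u - 2^-1)) 0.
    by rewrite /half_split /left_mass /right_mass tent0 mul0r subr0 addr0.
  have -> : C u 1 =
      blend t (Num.min u 2^-1) 2^-1 + blend t (Num.max 0 (u - 2^-1)) 2^-1.
    by rewrite /half_split /left_mass /right_mass tent1 mul1r subr0 addr0.
  split; last by rewrite !blendE.
  have blend0 a : 0 <= a -> blend t a 0 = 0.
    by move=> a_ge0; rewrite /blend min_r// !mulr0 addr0.
  by rewrite !blend0// addr0.
- move=> v; rewrite in_itv/= => v01; have /andP[v0 v1] := v01.
  have [/andP[g0 g1] /andP[k0 k1] _] := mass_bounds v01.
  rewrite /half_split [Num.min 0 _]min_l ?[Num.max 0 (0 - _)]max_l; [|lra..].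
  rewrite [Num.min 1 _]min_r ?[Num.max 0 (1 - _)]max_r; [|lra..].
  split; rewrite /blend; first by rewrite !min_l//; ring.
  rewrite !min_r//; last by lra.
  by rewrite /left_mass /right_mass; field.
- move=> u1 u2 v1 v2 _ _ _ _ uv1 uv2; rewrite /half_split.
  have a12 : Num.min u1 2^-1 <= Num.min v1 2^-1.
    by rewrite !minEle; do ?case: ifPn; lra.
  have b12 : Num.max 0 (u1 - 2^-1) <= Num.max 0 (v1 - 2^-1).
    by rewrite !maxEle; do ?case: ifPn; lra.
  have := tent_lipschitz uv2; rewrite ler_norml => /andP[h1 h2].
  have g12 : left_mass y u2 <= left_mass y v2 by rewrite /left_mass; lra.
  have k12 : right_mass y u2 <= right_mass y v2 by rewrite /right_mass; lra.
  have := blend_2increasing a12 g12; have := blend_2increasing b12 k12; lra.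
Qed.

(** Each of the two mixed copulas lies above the product, because
    [left_mass y v >= v / 2]. *)
Lemma half_split_PQD : copula_PQD R C.
Proof.
split; first exact: half_split_copula.
move=> u v; rewrite !in_itv/= => /andP[u0 u1] v01; have /andP[v0 v1] := v01.
have [/andP[g0 g1] /andP[k0 k1] gv] := mass_bounds v01.
have gk : left_mass y v + right_mass y v = v.
  by rewrite /left_mass /right_mass; field.
have /andP[t0 t1] := t01.
rewrite /half_split /blend.
move: (left_mass y v) (right_mass y v) g0 g1 k0 k1 gv gk => g k g0 g1 k0 k1 gv gk.
have [uh|/ltW uh] := leP u 2^-1.
  rewrite max_l; last by lra.
  rewrite [Num.min 0 _]min_l// !(mulr0, mul0r, addr0).
  have p1 : u * v <= 2 * u * g by nra.
  have p2 : u * v <= Num.min u g by rewrite le_min; apply/andP; split; nra.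
  by move: (Num.min u g) (2 * u * g) p1 p2 => p q *; nra.
rewrite max_r; last by lra.
rewrite [Num.min 2^-1 _]min_r//.
have p1 : u * v <= 2 * 2^-1 * g + 2 * (u - 2^-1) * k by nra.
have p2 : u * v <= g + Num.min (u - 2^-1) k.
  by rewrite minEle; case: ifPn => ?; nra.
move: (Num.min (u - 2^-1) k) (2 * 2^-1 * g) (2 * (u - 2^-1) * k) p1 p2 => *.
by nra.
Qed.

(** The reflection [(u, v) |-> (1 - u, 1 - v)] exchanges the two halves and, the
    tent being symmetric, their distribution functions of [V]. *)
Lemma half_split_RS : copula_RS R C.
Proof.
split; first exact: half_split_copula.
move=> u v _ _; rewrite /half_split.
have -> : Num.min (1 - u) 2^-1 = 2^-1 - Num.max 0 (u - 2^-1).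
  by rewrite minEle maxEle; do ?case: ifPn; lra.
have -> : Num.max 0 (1 - u - 2^-1) = 2^-1 - Num.min u 2^-1.
  by rewrite minEle maxEle; do ?case: ifPn; lra.
have -> : left_mass y (1 - v) = 2^-1 - right_mass y v.
  by rewrite /left_mass /right_mass tent_symm; field.
have -> : right_mass y (1 - v) = 2^-1 - left_mass y v.
  by rewrite /left_mass /right_mass tent_symm; field.
have blendC a m : blend t (2^-1 - a) (2^-1 - m) = 2^-1 - a - m + blend t a m.
  rewrite /blend (_ : Num.min (_ - _) _ = 2^-1 - a - m + Num.min a m).
    by field.
  by rewrite !minEle; do ?case: ifPn; lra.
have ab : Num.min u 2^-1 + Num.max 0 (u - 2^-1) = u.
  by rewrite minEle maxEle; do ?case: ifPn; lra.
have gk : left_mass y v + right_mass y v = v.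
  by rewrite /left_mass /right_mass; field.
by rewrite !blendC; lra.
Qed.

Lemma half_split_at_half (v : R) : 0 <= v <= 1 -> C 2^-1 v = left_mass y v.
Proof.
move=> v01; have [/andP[g0 g1] /andP[k0 k1] _] := mass_bounds v01.
rewrite /half_split /blend minxx max_l ?subrr// [Num.min 2^-1 _]min_r//.
by rewrite [Num.min 0 _]min_l//; field.
Qed.

Lemma half_split_beta : blomqvist_beta C = y.
Proof.
rewrite /blomqvist_beta half_split_at_half /left_mass /tent; last lra.
have /andP[y0 y1] := y01.
by rewrite subrr normr0 mul0r subr0 max_r; [field|lra].
Qed.

(** On each half the slice is affine with two slopes: the comonotone part
    contributes [t] until the available mass [m] is used up, and [0] after. *)
Lemma partial1_half_split (u v : R) : u \in `]0, 1[ -> v \in `[0, 1] ->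
  u != 2^-1 -> u != left_mass y v -> u != 2^-1 + right_mass y v ->
  let d m := 2 * (1 - t) * m in
  let m := if u < 2^-1 then left_mass y v else right_mass y v in
  partial1 C u v = d m \/ partial1 C u v = d m + t.
Proof.
rewrite !in_itv/= => /andP[u0 u1] v01 uh ug uk.
have [/andP[g0 g1] /andP[k0 k1] _] := mass_bounds v01.
have CE z : C z v = (1 - t) * (2 * Num.min z 2^-1 * left_mass y v) +
    t * Num.min (Num.min z 2^-1) (left_mass y v) +
    ((1 - t) * (2 * Num.max 0 (z - 2^-1) * right_mass y v) +
     t * Num.min (Num.max 0 (z - 2^-1)) (right_mass y v)) by [].
move: (left_mass y v) (right_mass y v) g0 g1 k0 k1 ug uk CE.
move=> g k g0 g1 k0 k1 ug uk CE.
have D := derive1_affine_itv (F := fun z => C z v) (u := u).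
rewrite /partial1.
case: ltP => [{}uh|uh']; last first.
  have {uh'}uh : 2^-1 < u by rewrite lt_neqAle eq_sym uh.
  have [{}uk|uk'] := ltP u (2^-1 + k).
    right; apply: (D 2^-1 (2^-1 + k) _ ((1 - t) * (g - k) + t * (g - 2^-1))).
      by rewrite in_itv/= uh.
    move=> z /andP[z0 zg]; rewrite CE.
    rewrite [Num.min z _]min_r; last by lra.
    rewrite [Num.min _ g]min_r; last by lra.
    rewrite [Num.max _ _]max_r; last by lra.
    rewrite [Num.min _ k]min_l; last by lra.
    by field.
  have {uk'}uk : 2^-1 + k < u by rewrite lt_neqAle eq_sym uk.
  left; apply: (D (2^-1 + k) 1 _ ((1 - t) * (g - k) + t * (g + k))).
    by rewrite in_itv/= uk.
  move=> z /andP[z0 zg]; rewrite CE.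
  rewrite [Num.min z _]min_r; last by lra.
  rewrite [Num.min _ g]min_r; last by lra.
  rewrite [Num.max _ _]max_r; last by lra.
  rewrite [Num.min _ k]min_r; last by lra.
  by field.
have [{}ug|ug'] := ltP u g.
  right; apply: (D 0 g _ 0); first by rewrite in_itv/= u0.
  move=> z /andP[z0 zg]; rewrite CE.
  rewrite [Num.min z _]min_l; last by lra.
  rewrite [Num.min z _]min_l; last by lra.
  rewrite [Num.max _ _]max_l; last by lra.
  by rewrite [Num.min 0 _]min_l//; ring.
have {ug'}ug : g < u by rewrite lt_neqAle eq_sym ug.
left; apply: (D g 2^-1 _ (t * g)); first by rewrite in_itv/= ug.
move=> z /andP[z0 zg]; rewrite CE.
rewrite [Num.min z _]min_l; last by lra.
rewrite [Num.min z _]min_r; last by lra.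
rewrite [Num.max _ _]max_l; last by lra.
by rewrite [Num.min 0 _]min_l//; ring.
Qed.

(** The derivative takes two values on each half, so the integral of its square
    follows from the increments of the slice by [Rintegral_sqr_eq]. *)
Lemma half_split_slice (v : R) : v \in `[0, 1] ->
  \int[mu]_(u in `[0, 1]) partial1 C u v ^+ 2 =
  (1 - t ^+ 2) * (v ^+ 2 + 4 * tent y v ^+ 2) + t ^+ 2 * v.
Proof.
move=> v01; have v01' : 0 <= v <= 1 by move: v01; rewrite in_itv.
have [f [mf f01 df [fl fr] ->]] := copula_slice_density half_split_copula v01.
have h0 : 0 <= 2^-1 :> R by lra.
have h1 : 2^-1 <= 1 :> R by lra.
rewrite half_split_at_half// in fl fr.
have aeF : Filter (almost_everywhere mu) by exact: (ae_filter_ringOfSetsType mu).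
(* The quadratic equation with roots [d] and [d + t]. *)
have sqr_root_eq (d p : R) : p = d \/ p = d + t ->
    p ^+ 2 = (2 * d + t) * p - d * (d + t).
  by case=> ->; ring.
have aed : {ae mu, forall u, u \in `[0, 1] ->
    u != 2^-1 /\
    (let m := if u < 2^-1 then left_mass y v else right_mass y v in
    let d := 2 * (1 - t) * m in
    f u ^+ 2 = (2 * d + t) * f u - d * (d + t))}.
  apply: (filterS _ (filterI (filterI (filterI (ae_neq 0) (ae_neq 1))
    (filterI (ae_neq 2^-1) (filterI (ae_neq (left_mass y v))
      (ae_neq (2^-1 + right_mass y v))))) df)).
  move=> u [[[u0 u1] [uh [ug uk]]] dfu]; rewrite in_itv/= => /andP[u0' u1'].
  split => //.
  have uoo : u \in `]0, 1[ by rewrite in_itv/= !lt_neqAle u0' u1' u1 eq_sym u0.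
  by rewrite -dfu//; apply: sqr_root_eq; exact: partial1_half_split.
pose dl := 2 * (1 - t) * left_mass y v.
pose dr := 2 * (1 - t) * right_mass y v.
rewrite (@Rintegral_sqr_eq _ f 0 2^-1 mf f01 h0 (2 * dl + t) (dl * (dl + t))).
rewrite (@Rintegral_sqr_eq _ f 2^-1 1 mf f01 h1 (2 * dr + t) (dr * (dr + t))).
- by rewrite fl fr /dl /dr /left_mass /right_mass; field.
- apply: filterS aed => u H; rewrite in_itv/= => /andP[hu u1].
  have [|uh] := H; first by rewrite in_itv/= u1 (le_trans h0).
  by rewrite ltNge hu.
- apply: filterS aed => u H; rewrite in_itv/= => /andP[u0 hu].
  have [|uh] := H; first by rewrite in_itv/= u0 (le_trans hu).
  by rewrite lt_neqAle uh hu.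
Qed.

Lemma half_split_xi :
  chatterjee_xi C = (1 - t ^+ 2) * (y ^+ 3 / 2) + t ^+ 2.
Proof.
rewrite /chatterjee_xi.
rewrite (@eq_Rintegral _ _ _ mu _
  (fun v : R => (1 - t ^+ 2) * (v ^+ 2 + 4 * tent y v ^+ 2) + t ^+ 2 * v)).
  by rewrite Rintegral_tent//; field.
by move=> v; rewrite inE => /half_split_slice.
Qed.

End extremal_family.

Theorem corollary8 (R : realType) :
  [set (chatterjee_xi C, blomqvist_beta C) | C in copula_PQD R] =
  [set (chatterjee_xi C, blomqvist_beta C) | C in copula_PQD R `&` copula_RS R]
  /\
  [set (chatterjee_xi C, blomqvist_beta C) | C in copula_PQD R `&` copula_RS R] =
  [set p : R * R | [/\ p.1 \in `[0, 1], p.2 \in `[0, 1] & p.2 ^+ 3 <= 2 * p.1]].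
Proof.
set PQD := [set _ | _ in copula_PQD R].
set RS := [set _ | _ in copula_PQD R `&` copula_RS R].
set region := [set p : R * R | _].
have RS_PQD : RS `<=` PQD by move=> _ [C [pC _] <-]; exists C.
have PQD_region : PQD `<=` region.
  move=> _ [C pC <-]; have /andP[y0 y1] := blomqvist_beta_PQD pC.
  have /andP[x0 x1] := chatterjee_xi_PQD pC.
  have y3 : 0 <= blomqvist_beta C ^+ 3 by exact: exprn_ge0.
  by split; rewrite ?in_itv/=; lra.
have region_RS : region `<=` RS.
  move=> [x y] [] /=; rewrite !in_itv/= => /andP[x0 x1] y01 xy.
  have /andP[y0 y1] := y01.
  have y3 : y ^+ 3 <= 1 by rewrite exprn_ile1.
  (* The weight [t] of the comonotone copula solves
     [(1 - t^2) (y^3 / 2) + t^2 = x], that is [t^2 = w]. *)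
  pose w := (x - y ^+ 3 / 2) / (1 - y ^+ 3 / 2).
  have d0 : 0 < 1 - y ^+ 3 / 2 by lra.
  have w0 : 0 <= w by rewrite /w divr_ge0//; lra.
  have w1 : w <= 1 by rewrite /w ler_pdivrMr//; lra.
  have t01 : 0 <= Num.sqrt w <= 1.
    by rewrite sqrtr_ge0 -[leRHS]sqrtr1 ler_wsqrtr.
  exists (half_split (Num.sqrt w) y).
    by split; [exact: half_split_PQD|exact: half_split_RS].
  rewrite half_split_xi// half_split_beta// sqr_sqrtr//; congr pair.
  by rewrite /w; field; lra.
have RS_region := subset_trans RS_PQD PQD_region.
by split; apply/seteqP; split => //; exact: subset_trans region_RS.
Qed.
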